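(* If $f:\mathbb{N}\to\mathbb{Q}$ is a bijection, then the dual space $X_f^*$ is isomorphic (linearly homeomorphic) to $Y_f$.
   Context: For a bijection $f:\mathbb{N}\to\mathbb{Q}$, let $\mathcal{C}_f$ be the family of all finite sets $F\subseteq\mathbb{N}$ on which $f$ is increasing (i.e. $n<k$ in $F$ implies $f(n)<f(k)$). For $x\in\mathbb{R}^{\mathbb{N}}$ let $\|x\|_f=\sup\{\sum_{i\in F}|x(i)|:F\in\mathcal{C}_f\}$. Let $Y_f=\{x\in\mathbb{R}^{\mathbb{N}}:\|x\|_f<\infty\}$ and $X_f=\{x\in\mathbb{R}^{\mathbb{N}}:\|x\cdot\chi_{[n,\infty)}\|_f\to0\}$; both are Banach spaces under $\|\cdot\|_f$. *)

(* Defs.v *)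
From HB Require Import structures.
From mathcomp Require Import all_boot all_order all_algebra finmap.
From mathcomp Require Import all_classical all_reals all_analysis.

Set Implicit Arguments.
Unset Strict Implicit.
Unset Printing Implicit Defensive.

Import Order.TTheory GRing.Theory Num.Theory.
Import numFieldTopology.Exports numFieldNormedType.Exports.

Local Open Scope classical_set_scope.
Local Open Scope ring_scope.

Section chain_norm.
Context {R : realType}.
Variable f : nat -> rat.

(* [0] is a natural number here. *)
Definition chains : set {fset nat} :=
  [set F | forall n k, n \in F -> k \in F -> (n < k)%N -> f n < f k].

Definition chain_norm (x : nat -> R) : \bar R :=
  ereal_sup [set (\sum_(i <- F) `|x i|)%:E | F in chains].

(* The pointwise product of [x] and the indicator function of [n, +oo). *)
Definition tail (x : nat -> R) (n : nat) : nat -> R :=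
  x \* \1_[set i | (n <= i)%N].

Lemma chain_norm_ge (x : nat -> R) F :
  chains F -> ((\sum_(i <- F) `|x i|)%:E <= chain_norm x)%E.
Proof. by move=> CF; apply: ereal_sup_ubound; exists F. Qed.

Lemma chain_norm_ge0 (x : nat -> R) : (0 <= chain_norm x)%E.
Proof.
have C0 : chains fset0 by move=> n k; rewrite in_fset0.
by apply: le_trans (chain_norm_ge x C0); rewrite lee_fin sumr_ge0.
Qed.

Lemma chain_norm_ge_coord (x : nat -> R) i : (`|x i|%:E <= chain_norm x)%E.
Proof.
have C1 : chains [fset i]%fset.
  by move=> n k; rewrite !inE => /eqP -> /eqP ->; rewrite ltnn.
by apply: le_trans (chain_norm_ge x C1); rewrite big_seq_fset1.
Qed.

Lemma chain_normD (x y : nat -> R) :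
  (chain_norm (x + y)%R <= chain_norm x + chain_norm y)%E.
Proof.
apply: ge_ereal_sup => _ [F CF <-].
apply: le_trans (leeD (chain_norm_ge x CF) (chain_norm_ge y CF)).
rewrite -EFinD lee_fin -big_split/=; apply: ler_sum => i _; exact: ler_normD.
Qed.

Lemma chain_normZ_le a (x : nat -> R) :
  (chain_norm (a *: x)%R <= `|a|%:E * chain_norm x)%E.
Proof.
apply: ge_ereal_sup => _ [F CF <-].
have a0 : (0 <= `|a|%:E)%E by rewrite lee_fin.
apply: le_trans (lee_wpmul2l a0 (chain_norm_ge x CF)).
rewrite -EFinM lee_fin mulr_sumr; apply: ler_sum => i _.
by rewrite -[(_ *: _) i]/(a * x i) normrM.
Qed.

Lemma chain_norm0 : chain_norm (0 : nat -> R) = 0%E.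
Proof.
apply/eqP; rewrite eq_le chain_norm_ge0 andbT.
by have := chain_normZ_le 0 0; rewrite scale0r normr0 mul0e.
Qed.

Lemma chain_norm_delta (x : nat -> R) n :
  (chain_norm (fun i => x i *+ (i == n))%R <= `|x n|%:E)%E.
Proof.
apply: ge_ereal_sup => _ [F CF <-]; rewrite lee_fin.
have [nF|nF] := boolP (n \in F).
  rewrite (big_fsetD1 n)//= eqxx mulr1n big_seq big1 ?addr0// => i.
  by rewrite !inE => /andP[/negbTE ->]; rewrite mulr0n normr0.
rewrite big_seq big1// => i iF.
by have [ein|] := eqVneq i n; [rewrite -ein iF in nF|rewrite mulr0n normr0].
Qed.

Lemma tailE (x : nat -> R) n i : tail x n i = x i *+ (n <= i)%N.
Proof.
rewrite /tail/= indicE mulr_natr; congr (_ *+ nat_of_bool _).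
exact: asboolb.
Qed.

Lemma tail0 (x : nat -> R) : tail x 0 = x.
Proof. by apply/funext => i; rewrite tailE leq0n mulr1n. Qed.

Lemma tailD (x y : nat -> R) n : tail (x + y) n = tail x n + tail y n.
Proof.
by apply/funext => i; rewrite -[RHS]/(tail x n i + tail y n i) !tailE mulrnDl.
Qed.

Lemma tailZ a (x : nat -> R) n : tail (a *: x) n = a *: tail x n.
Proof.
by apply/funext => i; rewrite tailE -[RHS]/(a * tail x n i) tailE mulrnAr.
Qed.

Lemma tailS (x : nat -> R) n :
  tail x n = tail x n.+1 + (fun i => x i *+ (i == n)).
Proof.
apply/funext => i; rewrite -[RHS]/(tail x n.+1 i + x i *+ (i == n)) !tailE.
by rewrite -mulrnDr; congr (_ *+ _); case: ltngtP.
Qed.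

Definition Yset : {pred nat -> R} := fun x => `[< (chain_norm x < +oo)%E >].

(* Convergence in [\bar R], so almost all tails have finite norm; this gives
   [Xset_sub_Yset] below. *)
Definition Xset : {pred nat -> R} :=
  fun x => `[< chain_norm (tail x n) @[n --> \oo] --> 0%E >].

Lemma Yset_submod : GRing.subsemimod_closed Yset.
Proof.
split; first split.
- by apply/asboolP; rewrite chain_norm0 ltry.
- move=> x y /asboolP xY /asboolP yY; apply/asboolP.
  exact: le_lt_trans (chain_normD x y) (lte_add_pinfty xY yY).
- move=> a x /asboolP xY; apply/asboolP.
  apply: le_lt_trans (chain_normZ_le a x) _.
  by apply: lte_mul_pinfty; rewrite ?lee_fin.
Qed.

Lemma Xset_submod : GRing.subsemimod_closed Xset.
Proof.
split; first split.
- apply/asboolP.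
  under eq_fun => n.
    rewrite (_ : tail 0 n = 0) ?chain_norm0; first over.
    by apply/funext => i; rewrite tailE mul0rn.
  exact: cvg_cst.
- move=> x y /asboolP xX /asboolP yX; apply/asboolP.
  apply: (@squeeze_cvge _ _ _ _ (cst 0%E) _
    (fun n => (chain_norm (tail x n) + chain_norm (tail y n))%E)).
  + by apply: nearW => n; rewrite chain_norm_ge0 tailD chain_normD.
  + exact: cvg_cst.
  + by rewrite -[0%E in X in _ --> X]adde0; apply: cvgeD.
- move=> a x /asboolP xX; apply/asboolP.
  apply: (@squeeze_cvge _ _ _ _ (cst 0%E) _
    (fun n => (`|a|%:E * chain_norm (tail x n))%E)).
  + by apply: nearW => n; rewrite chain_norm_ge0 tailZ chain_normZ_le.
  + exact: cvg_cst.
  + by rewrite -[0%E in X in _ --> X](mule0 `|a|%:E); apply: cvgeZl.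
Qed.

Lemma Xset_sub_Yset : {subset Xset <= Yset}.
Proof.
move=> x /asboolP xX; apply/asboolP.
have [n] : exists n, (chain_norm (tail x n) < +oo)%E.
  have : \forall n \near \oo, (chain_norm (tail x n) < 1)%E.
    have B : nbhs (0%E : \bar R) [set z : \bar R | (z < 1)%E].
      by apply: open_nbhs_nbhs; split; [exact: open_ereal_lt_ereal|exact: lte01].
    exact: xX B.
  move=> [N _ /(_ N (leqnn N))/= H]; exists N; exact: lt_trans H (ltry _).
elim: n => [|n IH]; first by rewrite tail0.
move=> xn; apply: IH; rewrite tailS.
apply: le_lt_trans (chain_normD _ _) _; apply: lte_add_pinfty => //.
exact: le_lt_trans (chain_norm_delta _ _) (ltry _).
Qed.

End chain_norm.

Section spaces.
Variables (R : realType) (f : nat -> rat).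

Record Yspace := MkY { Yval :> nat -> R; _ : Yval \in Yset f }.
Record Xspace := MkX { Xval :> nat -> R; _ : Xval \in Xset f }.

HB.instance Definition _ := [isSub for Yval].
HB.instance Definition _ := [Choice of Yspace by <:].
HB.instance Definition _ :=
  GRing.SubChoice_isSubLmodule.Build R (nat -> R) _ Yspace (@Yset_submod R f).

HB.instance Definition _ := [isSub for Xval].
HB.instance Definition _ := [Choice of Xspace by <:].
HB.instance Definition _ :=
  GRing.SubChoice_isSubLmodule.Build R (nat -> R) _ Xspace (@Xset_submod R f).

Lemma fine_chain_norm_eq0 (x : nat -> R) :
  x \in Yset f -> fine (chain_norm f x) = 0 -> x = 0.
Proof.
move=> /asboolP xY x0; apply/funext => i; apply/eqP.
rewrite -normr_le0 -lee_fin (le_trans (chain_norm_ge_coord f x i))//.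
by rewrite -[chain_norm f x]fineK ?x0// ge0_fin_numE// chain_norm_ge0.
Qed.

Lemma fine_chain_normD (x y : nat -> R) : x \in Yset f -> y \in Yset f ->
  fine (chain_norm f (x + y)) <= fine (chain_norm f x) + fine (chain_norm f y).
Proof.
move=> /asboolP xY /asboolP yY.
have xyY := le_lt_trans (chain_normD f x y) (lte_add_pinfty xY yY).
have N (z : nat -> R) : (chain_norm f z < +oo)%E -> chain_norm f z \is a fin_num.
  by move=> zY; rewrite ge0_fin_numE// chain_norm_ge0.
by rewrite -lee_fin EFinD !fineK ?N//; exact: chain_normD.
Qed.

Lemma fine_chain_normZ a (x : nat -> R) : x \in Yset f ->
  fine (chain_norm f (a *: x)) = `|a| * fine (chain_norm f x).
Proof.
have N (z : nat -> R) : z \in Yset f -> chain_norm f z \is a fin_num.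
  by move=> /asboolP zY; rewrite ge0_fin_numE// chain_norm_ge0.
have le b (z : nat -> R) : z \in Yset f ->
    fine (chain_norm f (b *: z)) <= `|b| * fine (chain_norm f z).
  move=> zY; have bzY := (@Yset_submod R f).2 b z zY.
  by rewrite -lee_fin EFinM !fineK ?N//; exact: chain_normZ_le.
move=> xY; apply/eqP; rewrite eq_le le//=.
have [->|a0] := eqVneq a 0.
  by rewrite normr0 mul0r fine_ge0// chain_norm_ge0.
rewrite -ler_pdivlMl ?normr_gt0// -normfV.
have := le a^-1 (a *: x) ((@Yset_submod R f).2 a x xY).
by rewrite scalerA mulVf// scale1r.
Qed.

(* [fine] discards nothing: [chain_norm] is finite on both spaces. *)
Definition Ynorm (x : Yspace) : R := fine (chain_norm f x).
Definition Xnorm (x : Xspace) : R := fine (chain_norm f x).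

Let XvalY (x : Xspace) : Xval x \in Yset f.
Proof. exact/Xset_sub_Yset/(valP x). Qed.

Fact YnormD (x y : Yspace) : Ynorm (x + y) <= Ynorm x + Ynorm y.
Proof. exact: fine_chain_normD (valP x) (valP y). Qed.

Fact YnormZ (a : R) (x : Yspace) : Ynorm (a *: x) = `|a| * Ynorm x.
Proof. exact: fine_chain_normZ (valP x). Qed.

Fact Ynorm_eq0 (x : Yspace) : Ynorm x = 0 -> x = 0.
Proof. by move=> x0; apply: val_inj; apply: fine_chain_norm_eq0 (valP x) x0. Qed.

HB.instance Definition _ := Lmodule_isNormed.Build R Yspace YnormD YnormZ Ynorm_eq0.

Fact XnormD (x y : Xspace) : Xnorm (x + y) <= Xnorm x + Xnorm y.
Proof. exact: fine_chain_normD (XvalY x) (XvalY y). Qed.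

Fact XnormZ (a : R) (x : Xspace) : Xnorm (a *: x) = `|a| * Xnorm x.
Proof. exact: fine_chain_normZ (XvalY x). Qed.

Fact Xnorm_eq0 (x : Xspace) : Xnorm x = 0 -> x = 0.
Proof. by move=> x0; apply: val_inj; apply: fine_chain_norm_eq0 (XvalY x) x0. Qed.

HB.instance Definition _ := Lmodule_isNormed.Build R Xspace XnormD XnormZ Xnorm_eq0.

End spaces.

Section dual.
Variables (R : realType) (V : normedModType R).

Definition dual_set : {pred V -> R} :=
  fun phi => `[< linear phi /\ continuous phi >].

Lemma dual_set_submod : GRing.subsemimod_closed dual_set.
Proof.
split; first split.
- apply/asboolP; split; last exact: cst_continuous.
  by move=> a x y; rewrite /= scaler0 addr0.
- move=> p q /asboolP[pl pc] /asboolP[ql qc]; apply/asboolP; split.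
    move=> a x y; rewrite -[LHS]/(p _ + q _) pl ql -[RHS]/(a *: (p x + q x) + (p y + q y)).
    by rewrite scalerDr addrACA.
  by move=> x; apply: continuousD; [exact: pc|exact: qc].
- move=> b p /asboolP[pl pc]; apply/asboolP; split.
    move=> a x y; rewrite -[LHS]/(b * p _) pl -[RHS]/(a * (b * p x) + b * p y) -[a *: p x]/(a * p x).
    by rewrite mulrDr mulrCA.
  by move=> x; apply: continuousM; [exact: cst_continuous|exact: pc].
Qed.

Record dual := MkDual { dual_fun :> V -> R; _ : dual_fun \in dual_set }.

HB.instance Definition _ := [isSub for dual_fun].
HB.instance Definition _ := [Choice of dual by <:].
HB.instance Definition _ :=
  GRing.SubChoice_isSubLmodule.Build R (V -> R) _ dual dual_set_submod.

Lemma dual_linear (phi : dual) : linear phi.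
Proof. by have /asboolP[] := valP phi. Qed.

Lemma dual_continuous (phi : dual) : continuous phi.
Proof. by have /asboolP[] := valP phi. Qed.

HB.instance Definition _ (phi : dual) :=
  GRing.isLinear.Build R V R *:%R (dual_fun phi) (dual_linear phi).

Definition dual_norm (phi : dual) : R :=
  sup [set `|phi x| | x in [set x : V | `|x| <= 1]].

Let dual_values (phi : dual) := [set `|phi x| | x in [set x : V | `|x| <= 1]].

Let has_sup_dual (phi : dual) : has_sup (dual_values phi).
Proof.
split; first by exists `|phi 0|, 0 => //=; rewrite normr0.
have := @continuous_linear_bounded R V R 0 phi (@dual_continuous phi 0).
move=> /bounded_funP/(_ 1)[M HM]; exists M => _ [x /= x1 <-]; exact: HM.
Qed.

Lemma dual_norm_ge (phi : dual) x : `|x| <= 1 -> `|phi x| <= dual_norm phi.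
Proof.
by move=> x1; apply: ub_le_sup; [exact: (has_sup_dual phi).2|exists x].
Qed.

Lemma dual_norm_le (phi : dual) M :
  (forall x, `|x| <= 1 -> `|phi x| <= M) -> dual_norm phi <= M.
Proof.
move=> H; apply: ge_sup; first exact: (has_sup_dual phi).1.
by move=> _ [x x1 <-]; exact: H.
Qed.

Fact dual_normD (phi psi : dual) :
  dual_norm (phi + psi) <= dual_norm phi + dual_norm psi.
Proof.
apply: dual_norm_le => x x1; apply: le_trans (ler_normD (phi x) (psi x)) _.
by apply: lerD; exact: dual_norm_ge.
Qed.

Fact dual_normZ (a : R) (phi : dual) :
  dual_norm (a *: phi) = `|a| * dual_norm phi.
Proof.
have le b (psi : dual) : dual_norm (b *: psi) <= `|b| * dual_norm psi.
  apply: dual_norm_le => x x1; rewrite -[(b *: psi) x]/(b * psi x) normrM.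
  by apply: ler_wpM2l => //; exact: dual_norm_ge.
apply/eqP; rewrite eq_le le/=.
have [->|a0] := eqVneq a 0.
  rewrite normr0 mul0r.
  by apply: le_trans (@dual_norm_ge _ 0 _); rewrite ?normr0// ler01.
rewrite -ler_pdivlMl ?normr_gt0// -normfV.
by have := le a^-1 (a *: phi); rewrite scalerA mulVf// scale1r.
Qed.

Fact dual_norm_eq0 (phi : dual) : dual_norm phi = 0 -> phi = 0.
Proof.
move=> phi0; apply: val_inj; apply/funext => x; apply/eqP.
have [->|x0] := eqVneq x 0; first by apply/eqP; exact: (linear0 phi).
have : `|phi (`|x|^-1 *: x)| <= 0.
  rewrite -phi0; apply: dual_norm_ge.
  by rewrite normrZ normfV normr_id mulVf ?normr_eq0.
by rewrite normr_le0 linearZ/= scaler_eq0 invr_eq0 normr_eq0 (negbTE x0).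
Qed.

HB.instance Definition _ :=
  Lmodule_isNormed.Build R dual dual_normD dual_normZ dual_norm_eq0.

End dual.

Definition isomorphic (R : realType) (V W : normedModType R) : Prop :=
  exists (T : {linear V -> W}) (S : {linear W -> V}),
    [/\ cancel T S, cancel S T, continuous T & continuous S].

(* Main.v *)
(* The sets on which [f] decreases are the antichains of the order
   [i < j /\ f i < f j], whose chains are the sets in [chains f]. A weighted
   form of Mirsky's theorem gives |sum_i x_i y_i| <= ||x||_f ||y||_(-f), and
   testing a functional on signed indicators of antichains gives the reverse
   bound, so phi |-> (phi(e_i))_i identifies the dual of X_f with Y_(-f).

   To pass from -f to f, pick greedily, by density of the rationals, an
   increasing map phi of nat such that f o phi reverses the order of f. It
   embeds each of f, -f into the other, so the Schroeder-Bernstein construction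
   yields a permutation h of nat that, on each of two pieces of nat, preserves
   the order of nat and reverses that of f. A chain splits into two pieces,
   hence x |-> x o h is an isomorphism of norm at most 2. *)
From HB Require Import structures.
Require Import Defs.
From mathcomp Require Import all_boot all_order all_algebra finmap.
From mathcomp Require Import all_classical all_reals all_analysis.
Import Order.TTheory GRing.Theory Num.Theory.
Import numFieldTopology.Exports numFieldNormedType.Exports.
Local Open Scope classical_set_scope.
Local Open Scope ring_scope.
Set Implicit Arguments.
Unset Strict Implicit.
Unset Printing Implicit Defensive.

(** * Density of the rationals and order-reversing maps of [nat] *)

Lemma rat_avoid (D : seq rat) (a b : rat) :
  a < b -> exists2 q, a < q < b & q \notin D.
Proof.
elim: D a b => [|d D IH] a b ab.
  by exists ((a + b) / 2); rewrite ?midf_lt.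
have [/andP[ad db]|nd] := boolP (a < d < b).
  have [q /andP[dq qb] qD] := IH d b db.
  by exists q; rewrite ?(lt_trans ad dq) // inE negb_or qD gt_eqF.
have [q aqb qD] := IH a b ab.
exists q => //; rewrite inE negb_or qD andbT.
by apply: contra nd => /eqP <-.
Qed.

(** [L] and [U] will hold the values already placed on either side of [q]; avoiding [D] will force
    the preimage of [q] under [f] to be a large index. *)
Lemma rat_cut (L U D : seq rat) :
  (forall l u, l \in L -> u \in U -> l < u) ->
  exists q, [/\ {in L, forall l, l < q}, {in U, forall u, q < u} & q \notin D].
Proof.
move=> LU.
have [a La aU] : exists2 a, {in L, forall l, l <= a} & {in U, forall u, a < u}.
  elim: L LU => [_|l L IH LU].
    elim: U => [|u U [a _ aU]]; first by exists 0.
    exists (Num.min a (u - 1)) => // v; rewrite inE => /predU1P[->|vU].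
      by rewrite gt_min orbC ltrBlDr ltrDl ltr01.
    by rewrite gt_min aU.
  have [|a La aU] := IH; first by move=> k u kL; apply: LU; rewrite inE kL orbT.
  exists (Num.max l a) => [k|u uU]; last by rewrite gt_max aU// LU// mem_head.
  by rewrite inE => /predU1P[->|kL]; rewrite le_max ?lexx// La ?orbT.
have [b ab bU] : exists2 b, a < b & {in U, forall u, b <= u}.
  elim: {LU} U aU => [_|u U IH aU]; first by exists (a + 1); rewrite ?ltrDl.
  have [|b ab bU] := IH; first by move=> v vU; apply: aU; rewrite inE vU orbT.
  exists (Num.min u b) => [|v]; first by rewrite lt_min ab aU ?mem_head.
  by rewrite inE => /predU1P[->|vU]; rewrite ge_min ?lexx// bU ?orbT.
have [q /andP[aq qb] qD] := rat_avoid D ab; exists q; split => //.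
  by move=> l /La la; apply: le_lt_trans la aq.
by move=> u /bU; apply: lt_le_trans.
Qed.

Section order_reversing.
Variable f : nat -> rat.

(** [s] lists the first values of the map under construction: its entry [i] is the image of [i]. *)
Definition reverses (s : seq nat) :=
  forall i j, (i < size s)%N -> (j < size s)%N ->
    (f (nth 0 s i) < f (nth 0 s j)) = (f j < f i).

(** Since [s] reverses the order, the values that must lie below the new one and those that must lie
    above it form a cut. The preimage of a rational in this cut that differs from [f 0, ..., f N]
    serves as [m]. *)
Lemma reverses_rcons (s : seq nat) (N : nat) : bijective f -> reverses s ->
  exists2 m, (N < m)%N & reverses (rcons s m).
Proof.
move=> bf rs; have [g fK gK] := bf; pose n := size s.
pose g' i := f (nth 0%N s i).
have [|q [Lq qU qD]] := @rat_cut [seq g' i | i <- iota 0 n & f n < f i]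
  [seq g' i | i <- iota 0 n & f i < f n] [seq f i | i <- iota 0 N.+1].
  move=> _ _ /mapP[i + ->] /mapP[j + ->].
  rewrite !mem_filter !mem_iota !add0n => /andP[fi il] /andP[fj jl].
  by rewrite /g' rs//; apply: lt_trans fj fi.
have rgq i : (i < n)%N ->
    ((g' i < q) = (f n < f i)) * ((q < g' i) = (f i < f n)).
  move=> il.
  have [H|H|/(can_inj fK) H] := ltgtP (f n) (f i); last by rewrite H ltnn in il.
    have gq : g' i < q by apply/Lq/map_f; rewrite mem_filter H mem_iota.
    by rewrite gq lt_gtF.
  have gq : q < g' i by apply/qU/map_f; rewrite mem_filter H mem_iota.
  by rewrite gq lt_gtF.
exists (g q).
  rewrite ltnNge; apply: contra qD => gN; apply/mapP; exists (g q) => //.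
  by rewrite mem_iota ltnS.
move=> i j; rewrite size_rcons !ltnS -/n (leq_eqVlt i) (leq_eqVlt j).
have E k : (k < n)%N -> nth 0%N (rcons s (g q)) k = nth 0%N s k.
  by move=> kn; rewrite nth_rcons kn.
have En : nth 0%N (rcons s (g q)) n = g q by rewrite nth_rcons ltnn eqxx.
move=> /predU1P[->|il] /predU1P[->|jl]; rewrite ?En ?E// ?gK ?ltxx//.
- by have [_ <-] := rgq j jl.
- by have [<- _] := rgq i il.
- exact: rs.
Qed.

Lemma order_reversing_embedding : bijective f -> exists phi : nat -> nat,
  [/\ {homo phi : n k / (n < k)%N}, forall n, (n < phi n)%N
    & forall i j, (f (phi i) < f (phi j)) = (f j < f i)].
Proof.
move=> bf.
(* [foldr maxn (size s) s] dominates the length and every entry of [s], so one choice gives both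
   [n < phi n] and monotonicity. *)
have /choice[F HF] : forall s, exists m, reverses s ->
    (foldr maxn (size s) s < m)%N /\ reverses (rcons s m).
  move=> s; have [rs|nrs] := pselect (reverses s); last by exists 0%N => /nrs.
  by have [m ? ?] := reverses_rcons (foldr maxn (size s) s) bf rs; exists m.
pose s n := iter n (fun t => rcons t (F t)) [::].
have sS n : s n.+1 = rcons (s n) (F (s n)) by [].
have ss n : size (s n) = n by elim: n => // n IH; rewrite sS size_rcons IH.
have rs n : reverses (s n) by elim: n => [i j|n IH] //; have [] := HF _ IH.
pose phi n := F (s n).
have sE n i : (i < n)%N -> nth 0%N (s n) i = phi i.
  elim: n => // n IH; rewrite sS nth_rcons ss ltnS leq_eqVlt => /predU1P[->|il].
    by rewrite ltnn eqxx.
  by rewrite il IH.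
have foldr_max t c x : x \in c :: t -> (x <= foldr maxn c t)%N.
  elim: t => [|y t IH]; first by rewrite inE => /eqP ->.
  rewrite !inE orbCA leq_max => /predU1P[->|H]; first by rewrite leqnn.
  by rewrite IH ?orbT // inE.
exists phi; split.
- move=> n k nk; rewrite -(sE _ _ nk).
  have [+ _] := HF _ (rs k); apply: leq_ltn_trans; apply: foldr_max.
  by rewrite inE mem_nth ?orbT// ss.
- move=> n; have [+ _] := HF _ (rs n); apply: leq_ltn_trans.
  by rewrite -{1}(ss n); apply: foldr_max; rewrite mem_head.
- move=> i j; have iM := leq_maxl i.+1 j.+1; have jM := leq_maxr i.+1 j.+1.
  rewrite -(sE _ _ iM) -(sE _ _ jM); apply: rs; rewrite ss//.
Qed.

End order_reversing.

(** * A Schroeder-Bernstein permutation of [nat] *)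

(** For injective [phi] with [n < phi n], pulling [m] back along [phi] stops after finitely many
    steps; the predicate says that their number is even. *)
Inductive even_depth (phi : nat -> nat) : nat -> Prop :=
| EvenDepth0 m : (forall k, m <> phi k) -> even_depth phi m
| EvenDepthS m : even_depth phi m -> even_depth phi (phi (phi m)).

(** One direction is an induction on the derivation, with injectivity stripping [phi]; the other is
    a strong induction on [n], as preimages under [phi] are smaller. *)
Lemma even_depth_phi (phi : nat -> nat) (n : nat) :
  injective phi -> (forall n, (n < phi n)%N) ->
  even_depth phi (phi n) <-> ~ even_depth phi n.
Proof.
move=> iphi ltphi; split.
  move=> + en; elim: en => {n} [m mphi|m _ IH] en.
    inversion en as [k kphi eq|k ek eq]; first by case: (kphi m).
    by case: (mphi k); apply: iphi.
  inversion en as [k kphi eq|k ek eq]; first by case: (kphi (phi (phi m))).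
  by apply: IH; rewrite -(iphi _ _ (iphi _ _ eq)).
have [N] := ubnP n; elim: N n => // N IH n; rewrite ltnS => nN odd_n.
have [[k nk]|nphi] := pselect (exists k, n = phi k); last first.
  by case: odd_n; left => k nk; apply: nphi; exists k.
rewrite nk; right; apply: contrapT => odd_k; apply: odd_n; rewrite nk.
by apply: IH => //; apply: leq_trans nN; rewrite nk.
Qed.

(* Schroeder-Bernstein for the embedding [phi] of [f] into [- f] and of [- f]
   into [f]: both directions use the same map, which makes [h] an involution. *)
Lemma piecewise_order_reversal (f : nat -> rat) : bijective f ->
  exists (h : nat -> nat) (P : pred nat), involutive h /\
    forall n k, P n = P k ->
      (h n < h k)%N = (n < k)%N /\ (f (h n) < f (h k)) = (f k < f n).
Proof.
move=> /order_reversing_embedding[phi [mphi ltphi rphi]].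
have lphi : {mono phi : n k / (n < k)%N} by apply: leqW_mono; apply: leq_mono.
have iphi : injective phi.
  by apply: incn_inj => //; apply: leq_mono.
pose P n := `[< even_depth phi n >].
have Pphi n : P (phi n) = ~~ P n.
  by rewrite /P -asbool_neg; apply: asbool_equiv_eq; apply: even_depth_phi.
have /choice[psi psiE] : forall n, exists m, ~~ P n -> n = phi m.
  move=> n; have [Pn|/asboolPn nPn] := boolP (P n); first by exists 0%N.
  apply: contrapT => H; apply: nPn; left => k nk; apply: H; by exists k.
(* [h] exchanges the two parities of depth: it is [phi] on even depth and the inverse of [phi] on
   odd depth. *)
exists (fun n => if P n then phi n else psi n), P; split.
  move=> n; have [Pn|Pn] := boolP (P n).
    rewrite Pphi Pn /=; apply: iphi; rewrite -psiE// Pphi Pn//.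
  by move: (Pn); rewrite {1}(psiE _ Pn) Pphi negbK => -> ; rewrite -psiE.
move=> n k Pnk; rewrite Pnk; case: ifPn => Pk.
  by rewrite lphi rphi.
(* On odd depth [n = phi (psi n)], so the properties of [phi] are read at [psi n] and [psi k]. *)
have Pn : ~~ P n by rewrite Pnk.
by rewrite -lphi -rphi -!psiE.
Qed.

(** * Isomorphisms of normed spaces from operator bounds *)

Lemma linear_continuous_of_bound (R : realType) (V W : normedModType R)
    (T : V -> W) (C : R) :
  linear T -> (forall x, `|T x| <= C * `|x|) -> continuous T.
Proof.
move=> linT boundT.
pose T' : {linear V -> W} := HB.pack T (GRing.isLinear.Build _ _ _ _ T linT).
apply: (bounded_linear_continuous (f := T')); apply/linear_boundedP.
apply: filterS (nbhs_pinfty_ge (num_real C)) => r Cr x.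
by apply: le_trans (boundT x) _; exact: ler_wpM2r.
Qed.

Lemma isomorphic_of_bounds (R : realType) (V W : normedModType R)
    (T : V -> W) (S : W -> V) (C D : R) :
  linear T -> cancel T S -> cancel S T ->
  (forall x, `|T x| <= C * `|x|) -> (forall y, `|S y| <= D * `|y|) ->
  isomorphic V W.
Proof.
move=> linT TK SK boundT boundS.
have linS : linear S.
  by move=> a x y; apply: (can_inj TK); rewrite linT !SK.
pose T' : {linear V -> W} := HB.pack T (GRing.isLinear.Build _ _ _ _ T linT).
pose S' : {linear W -> V} := HB.pack S (GRing.isLinear.Build _ _ _ _ S linS).
by exists T', S'; split => //;
  [exact: linear_continuous_of_bound boundT
  |exact: linear_continuous_of_bound boundS].
Qed.

Lemma isomorphic_trans (R : realType) (U V W : normedModType R) :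
  isomorphic U V -> isomorphic V W -> isomorphic U W.
Proof.
move=> [T [S [TK SK cT cS]]] [T' [S' [TK' SK' cT' cS']]].
exists (T' \o T), (S \o S'); split.
- exact: can_comp.
- exact: can_comp.
- by move=> x; apply: continuous_comp; [exact: cT|exact: cT'].
- by move=> x; apply: continuous_comp; [exact: cS'|exact: cS].
Qed.

(** * Chain norms: rearrangement by a permutation and the chain-antichain inequality *)

Section chain_norm_theory.
Variable R : realType.
Implicit Types (f g : nat -> rat) (x y : nat -> R).

Lemma chain_norm_le f x (M : \bar R) :
  (forall F, chains f F -> (\sum_(i <- F) `|x i|)%:E <= M)%E ->
  (chain_norm f x <= M)%E.
Proof. by move=> H; apply: ge_ereal_sup => _ [F CF <-]; exact: H. Qed.

Lemma fine_chain_norm_ge f x F : x \in Yset f -> chains f F ->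
  \sum_(i <- F) `|x i| <= fine (chain_norm f x).
Proof.
move=> /asboolP xY CF; rewrite -lee_fin fineK ?chain_norm_ge//.
by rewrite ge0_fin_numE// chain_norm_ge0.
Qed.

(** A chain of [f] splits into its parts inside and outside [P]; [h] maps each part bijectively onto
    a chain of [g], at the cost of one [chain_norm g x]. *)
Lemma chain_norm_comp f g (h : nat -> nat) (P : pred nat) x : injective h ->
  (forall n k, P n = P k -> (n < k)%N -> f n < f k ->
    (h n < h k)%N /\ g (h n) < g (h k)) ->
  (chain_norm f (x \o h) <= chain_norm g x + chain_norm g x)%E.
Proof.
move=> hI hP; apply: chain_norm_le => F CF.
rewrite (big_fsetID _ P) EFinD.
have part (Q : pred nat) : (forall n k, Q n -> Q k -> P n = P k) ->
    ((\sum_(i <- [fset i in F | Q i]%fset) `|x (h i)|)%:E <= chain_norm g x)%E.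
  move=> QP; set G := [fset i in F | Q i]%fset.
  have <- : \sum_(i <- [fset h n | n in G]%fset) `|x i| =
            \sum_(i <- G) `|x (h i)|.
    by rewrite big_imfset//= => n k _ _; exact: hI.
  apply: chain_norm_ge => _ _ /imfsetP[n /= + ->] /imfsetP[k /= + ->].
  rewrite !inE => /andP[nF Qn] /andP[kF Qk] hnk.
  (* The order of [n] and [k] is recovered from that of their images: [k < n] would give
     [h k < h n]. *)
  have [nk|kn|nk] := ltngtP n k; last by rewrite nk ltnn in hnk.
    by have [] := hP n k (QP _ _ Qn Qk) nk (CF _ _ nF kF nk).
  have [hkn _] := hP k n (QP _ _ Qk Qn) kn (CF _ _ kF nF kn).
  by rewrite ltnNge (ltnW hkn) in hnk.
apply: leeD; apply: part => n k; first by move=> -> ->.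
by move=> /negbTE -> /negbTE ->.
Qed.

(** Composition with the involution [h] is its own inverse, and on each piece [h] turns chains of
    [f] into chains of [- f] and conversely. *)
Lemma Yspace_opp_isomorphic f : bijective f ->
  isomorphic (Yspace R (fun n => - f n)) (Yspace R f).
Proof.
move=> /piecewise_order_reversal[h [P [hK hP]]].
have hI := inv_inj hK.
have toY g k x : x \in Yset k ->
    (forall n m, P n = P m -> (n < m)%N -> g n < g m ->
      (h n < h m)%N /\ k (h n) < k (h m)) ->
    x \o h \in Yset g /\
    fine (chain_norm g (x \o h)) <= 2 * fine (chain_norm k x).
  move=> xY gkP; have le2 := chain_norm_comp x hI gkP.
  have fx : chain_norm k x \is a fin_num.
    by rewrite ge0_fin_numE ?chain_norm_ge0//; apply/asboolP.
  have xhY : x \o h \in Yset g.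
    by apply/asboolP; apply: le_lt_trans le2 _;
      rewrite lte_add_pinfty// ltey_eq fx.
  split=> //; rewrite mulrDl !mul1r -lee_fin EFinD !fineK//.
  by rewrite ge0_fin_numE ?chain_norm_ge0//; apply/asboolP.
have fP n m : P n = P m -> (n < m)%N -> f n < f m ->
    (h n < h m)%N /\ - f (h n) < - f (h m).
  move=> Pnm nm fnm; rewrite ltrN2; have [_ ->] := hP m n (esym Pnm).
  by have [-> _] := hP n m Pnm.
have NfP n m : P n = P m -> (n < m)%N -> - f n < - f m ->
    (h n < h m)%N /\ f (h n) < f (h m).
  by move=> Pnm nm; rewrite ltrN2; have [-> ->] := hP n m Pnm.
pose T (x : Yspace R (fun n => - f n)) : Yspace R f :=
  MkY (toY f _ _ (valP x) fP).1.
pose S (x : Yspace R f) : Yspace R (fun n => - f n) :=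
  MkY (toY _ f _ (valP x) NfP).1.
apply: (@isomorphic_of_bounds _ _ _ T S 2 2).
- by move=> a x y; apply: val_inj.
- by move=> x; apply: val_inj; apply/funext => n /=; rewrite hK.
- by move=> x; apply: val_inj; apply/funext => n /=; rewrite hK.
- by move=> x; exact: (toY f _ _ (valP x) fP).2.
- by move=> x; exact: (toY _ f _ (valP x) NfP).2.
Qed.

(* Weighted Mirsky: peel off a multiple of the antichain of minimal elements,
   which every maximal chain meets, so the bound on chain sums drops by that
   multiple. *)
Lemma chain_antichain_holder f (S : {fset nat}) x y (M N : R) :
  injective f -> {in S, forall i, 0 <= x i} ->
  (forall F, (F `<=` S)%fset -> chains f F -> \sum_(i <- F) x i <= M) ->
  (forall F, (F `<=` S)%fset -> chains (fun n => - f n) F ->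
     \sum_(i <- F) y i <= N) ->
  \sum_(i <- S) x i * y i <= M * N.
Proof.
move=> fI; have [n] := ubnP #|` S|; elim: n S x M => // n IH S x M.
rewrite ltnS => Sn x0 xM yN.
have [->|[s sS]] := fset_0Vmem S.
  have C0 g : chains g fset0 by move=> ? ?; rewrite in_fset0.
  have M0 := xM _ (fsub0set _) (C0 f); have N0 := yN _ (fsub0set _) (C0 _).
  by rewrite !big_seq_fset0 in M0 N0 *; exact: mulr_ge0.
pose minimal i := all (fun j => ~~ ((j < i)%N && (f j < f i))) S.
pose A := [fset i in S | minimal i]%fset.
(* Descent on [c]: below a non-minimal element there is a smaller one. *)
have below c : c \in S -> c \notin A ->
    exists2 a, a \in A & (a < c)%N && (f a < f c).
  have [m] := ubnP c; elim: m c => // m IHm c; rewrite ltnS => cm cS.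
  rewrite !inE cS /= -has_predC => /hasP[a aS /= /negPn ac].
  have [aA|aA] := boolP (a \in A); first by exists a.
  have /andP[ac1 ac2] := ac.
  have [b bA /andP[ba fba]] := IHm a (leq_trans ac1 cm) aS aA.
  by exists b; rewrite // (ltn_trans ba ac1) (lt_trans fba ac2).
have [a0 a0A] : exists a, a \in A.
  have [sA|sA] := boolP (s \in A); first by exists s.
  by have [a aA _] := below s sS sA; exists a.
(* The multiple peeled off is the least weight on [A]: the new weights stay nonnegative and vanish
   at the minimiser, so the induction passes to [S] without it. *)
pose a := [arg min_(i < [` a0A]%fset) x (val i)]%O.
have [la aA] : (forall i, i \in A -> x (val a) <= x i) /\ val a \in A.
  rewrite /a; case: arg_minP => // i _ H; split; last exact: valP.
  by move=> j jA; exact: (H [` jA]%fset).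
move: (val a) la aA => {}a la aA.
have AS : (A `<=` S)%fset by apply/fsubsetP => i; rewrite !inE => /andP[].
have aS := fsubsetP AS _ aA.
pose x' i := x i - x a *+ (i \in A).
have CA : chains (fun n => - f n) A.
  move=> i j; rewrite !inE => /andP[iS _] /andP[_ /allP/(_ i iS)] + ij.
  rewrite ij /= -leNgt ltrN2 le_eqVlt => /predU1P[/fI ji|//].
  by rewrite ji ltnn in ij.
have sumA : \sum_(i <- A) y i = \sum_(i <- S) y i *+ (i \in A).
  rewrite -(big_fset_incl _ AS) => [|i _ /negbTE ->//].
  by apply: eq_big_seq => i ->.
have -> : \sum_(i <- S) x i * y i =
    x a * \sum_(i <- A) y i + \sum_(i <- (S `\ a)%fset) x' i * y i.
  have -> : \sum_(i <- (S `\ a)%fset) x' i * y i = \sum_(i <- S) x' i * y i.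
    by rewrite [RHS](big_fsetD1 a)//= /x' aA mulr1n subrr mul0r add0r.
  rewrite sumA mulr_sumr -big_split/=; apply: eq_bigr => i _.
  by rewrite /x' mulrBl mulrnAr mulrnAl addrC subrK.
rewrite -[M](subrKC (x a)) mulrDl lerD//.
  by apply: ler_wpM2l; [exact: x0|exact: yN].
apply: IH.
- by rewrite (cardfsD1 a S) aS in Sn.
- move=> i; rewrite !inE /x' => /andP[_ iS].
  by have [iA|_] := boolP (i \in A);
    rewrite ?mulr1n ?mulr0n ?subr0 ?subr_ge0 ?la ?x0.
- move=> F /fsubsetD1P[FS aF] CF.
  (* A chain meeting [A] loses at least [x a]; one missing [A] extends downwards by some [b] in [A],
     and [x a <= x b] gives the same bound. *)
  have [/hasP[b bF /= bA]|/hasPn/= FA] := boolP (has (fun i => i \in A) F).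
    rewrite sumrB lerB ?xM// (big_fsetD1 b)//= bA mulr1n lerDl sumr_ge0// => i _.
    by rewrite mulrn_wge0// x0.
  rewrite (eq_big_seq x) => [|i /FA /negbTE iA]; last first.
    by rewrite /x' iA mulr0n subr0.
  have xab b : b \in A -> chains f (b |` F)%fset -> b \notin F ->
      \sum_(i <- F) x i <= M - x a.
    move=> bA CbF bF; rewrite lerBrDl; apply: le_trans (xM _ _ CbF); last first.
      apply/fsubsetP => i; rewrite !inE => /predU1P[->|/(fsubsetP FS)//].
      exact: (fsubsetP AS).
    by rewrite big_fsetU1//= lerD2r la.
  have [F0|[s' s'F]] := fset_0Vmem F.
    apply: (xab a) => //; rewrite F0 fsetU0.
    by move=> i j; rewrite !inE => /eqP -> /eqP ->; rewrite ltnn.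
  (* [c] is the first element of [F], so an element of [A] below [c] lies below all of [F]. *)
  pose c := [arg min_(i < [` s'F]%fset) val i]%N.
  have [lc cF] : (forall i, i \in F -> (val c <= i)%N) /\ val c \in F.
    rewrite /c; case: arg_minnP => // i _ H; split; last exact: valP.
    by move=> j jF; exact: (H [` jF]%fset).
  move: (val c) lc cF => {}c lc cF.
  have [b bA /andP[bc fbc]] := below c (fsubsetP FS _ cF) (FA _ cF).
  apply: (xab b) => //; last by apply/negP => /lc; rewrite leqNgt bc.
  have bF j : j \in F -> (b < j)%N /\ f b < f j.
    move=> jF; have := lc j jF; rewrite leq_eqVlt => /predU1P[<-//|cj].
    by split; [exact: ltn_trans cj|exact: lt_trans (CF _ _ cF jF cj)].
  move=> i j; rewrite !inE => /predU1P[->|iF] /predU1P[->|jF]; rewrite ?ltnn//.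
  + by move=> _; have [] := bF j jF.
  + by move=> ib; have [bi _] := bF i iF; have := ltn_trans ib bi; rewrite ltnn.
  + exact: CF.
- by move=> F FS; apply: yN; apply: fsubset_trans FS (fsubD1set _ _).
Qed.

Lemma chain_antichain_meet f F A i j :
  chains f F -> chains (fun n => - f n) A ->
  i \in F -> j \in F -> i \in A -> j \in A -> i = j.
Proof.
move=> CF CA iF jF iA jA; have [ij|ji|//] := ltngtP i j.
  by have := CA _ _ iA jA ij; rewrite ltrN2 (lt_gtF (CF _ _ iF jF ij)).
by have := CA _ _ jA iA ji; rewrite ltrN2 (lt_gtF (CF _ _ jF iF ji)).
Qed.

(** * Duality between [Xspace] of [f] and [Yspace] of [- f] *)

Section duality.
Variable f : nat -> rat.
Hypothesis fI : injective f.
Let nf n := - f n.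

(** The limit is meaningful only for convergent series; [normed_series_cvg] ensures this for [x] in
    [Yset f] and [y] in [Yset nf]. *)
Let pairing x y : R := limn (series (fun i => x i * y i)).

Let normed_series_le x y n : x \in Yset f -> y \in Yset nf ->
  [normed series (fun i => x i * y i)] n <=
    fine (chain_norm f x) * fine (chain_norm nf y).
Proof.
move=> xY yY; rewrite /= seriesEnat/=.
under eq_bigr do rewrite normrM.
have -> : \sum_(0 <= i < n) `|x i| * `|y i| =
    \sum_(i <- [fset i in iota 0 n]%fset) `|x i| * `|y i|.
  apply: perm_big; apply: uniq_perm; rewrite ?iota_uniq ?fset_uniq//.
  by move=> i; rewrite !inE /index_iota subn0.
apply: (@chain_antichain_holder f _ (fun i => `|x i|) (fun i => `|y i|)) => //.
- by move=> F _; exact: fine_chain_norm_ge.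
- by move=> F _; exact: fine_chain_norm_ge.
Qed.

Let normed_series_cvg x y : x \in Yset f -> y \in Yset nf ->
  cvgn [normed series (fun i => x i * y i)].
Proof.
move=> xY yY; apply: nondecreasing_is_cvgn.
  by apply: nondecreasing_series => n _ _; exact: normr_ge0.
exists (fine (chain_norm f x) * fine (chain_norm nf y)) => _ [n _ <-].
exact: normed_series_le.
Qed.

Let pairing_le x y : x \in Yset f -> y \in Yset nf ->
  `|pairing x y| <= fine (chain_norm f x) * fine (chain_norm nf y).
Proof.
move=> xY yY; have cv := normed_series_cvg xY yY.
apply: le_trans (lim_series_norm cv) _; apply: limr_le => //.
by apply: nearW => n; exact: normed_series_le.
Qed.

Let XvalY (x : Xspace R f) : Xval x \in Yset f.
Proof. exact/Xset_sub_Yset/(valP x). Qed.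

Let pairing_linear y : y \in Yset nf ->
  linear (fun x : Xspace R f => pairing (Xval x) y).
Proof.
move=> yY a x z.
have cx := normed_cvg (normed_series_cvg (XvalY x) yY).
have cz := normed_cvg (normed_series_cvg (XvalY z) yY).
rewrite /pairing -lim_seriesZ// -lim_seriesD//; last exact: is_cvg_seriesZ.
congr (limn (series _)); apply/funext => i.
by rewrite -[LHS]/((a * Xval x i + Xval z i) * y i) mulrDl -mulrA.
Qed.

Let pairing_dual (y : Yspace R nf) :
  (fun x : Xspace R f => pairing (Xval x) (Yval y))
    \in @dual_set R (Xspace R f).
Proof.
apply/asboolP; split; first exact: pairing_linear (valP y).
apply: (@linear_continuous_of_bound _ _ _ _ `|y|).
  exact: pairing_linear (valP y).
by move=> x; rewrite mulrC; exact: pairing_le (XvalY x) (valP y).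
Qed.

Let unit_vec_X n : (fun i => (i == n)%:R) \in @Xset R f.
Proof.
apply/asboolP; apply: cvg_near_cst; exists n.+1 => // m /= nm.
rewrite (_ : tail _ m = 0) ?chain_norm0//; apply/funext => i; rewrite tailE.
have [->|//] := eqVneq i n; last by rewrite mul0rn.
by rewrite leqNgt nm mulr0n.
Qed.

Let unit_vec n : Xspace R f := MkX (unit_vec_X n).

(** The remainder of the expansion of [x] in unit vectors is a tail of [x], which tends to 0 by
    definition of [Xset]; continuity of [phi] concludes. *)
Let functional_series (phi : dual (Xspace R f)) (x : Xspace R f) :
  series (fun i => Xval x i * phi (unit_vec i)) n @[n --> \oo] --> phi x.
Proof.
pose t n : Xspace R f := x - \sum_(0 <= i < n) Xval x i *: unit_vec i.
have valt n : Xval (t n) = tail (Xval x) n.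
  elim: n => [|n IH]; first by rewrite /t big_geq// subr0 tail0.
  apply: (addIr (fun i => Xval x i *+ (i == n))); rewrite -tailS -IH.
  rewrite /t big_nat_recr//= opprD addrA -[LHS]/(_ - _ + _) -/(t n).
  apply/funext => i.
  rewrite -[LHS]/(Xval (t n) i - Xval x n * (i == n)%:R + Xval x i *+ (i == n)).
  by have [->|_] := eqVneq i n; rewrite ?mulr1 ?mulr0 ?subr0 ?addr0// subrK.
have -> : series (fun i => Xval x i * phi (unit_vec i)) =
    (fun n => phi x - phi (t n)).
  apply/funext => n; rewrite linearB opprB addrC subrK linear_sum.
  by apply: eq_bigr => i _; rewrite linearZ.
have t0 : t n @[n --> \oo] --> (0 : Xspace R f).
  apply/norm_cvg0P; apply: fine_cvg.
  under eq_fun do rewrite valt.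
  by have /asboolP := valP x.
rewrite -[X in _ --> X](subr0 (phi x)); apply: cvgB; first exact: cvg_cst.
rewrite -(linear0 phi); apply: continuous_cvg t0; exact: dual_continuous.
Qed.

(** [phi] is tested on the signed indicator [v] of an antichain [A]; a chain meets [A] at most once,
    so [v] has norm at most 1. *)
Let functional_coord (phi : dual (Xspace R f)) :
  (chain_norm nf (fun i => phi (unit_vec i)) <= `|phi|%:E)%E.
Proof.
apply: chain_norm_le => A CA; rewrite lee_fin.
pose v := \sum_(i <- A) Num.sg (phi (unit_vec i)) *: unit_vec i.
have -> : \sum_(i <- A) `|phi (unit_vec i)| = phi v.
  by rewrite linear_sum; apply: eq_bigr => i _; rewrite linearZ/= normrEsg.
apply: le_trans (ler_norm _) _; apply: dual_norm_ge.
rewrite -lee_fin fineK; last first.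
  by rewrite ge0_fin_numE ?chain_norm_ge0//; apply/asboolP; exact: XvalY.
apply: chain_norm_le => F CF; rewrite lee_fin.
have vE j : `|Xval v j| <= (j \in A)%:R.
  have -> : Xval v j = \sum_(i <- A) Num.sg (phi (unit_vec i)) * (j == i)%:R.
    by rewrite -[Xval v]/(val v) linear_sum fct_sumE.
  have [jA|jA] := boolP (j \in A).
    rewrite (big_fsetD1 j)//= eqxx mulr1 big_seq big1 => [|i].
      by rewrite addr0 normr_sg; case: (_ != 0).
    by rewrite !inE eq_sym => /andP[/negbTE -> _]; rewrite mulr0.
  rewrite big_seq big1 ?normr0// => i iA.
  by have [ji|] := eqVneq j i; [rewrite ji iA in jA|rewrite mulr0].
apply: le_trans (ler_sum _ (fun j _ => vE j)) _.
have [/hasP[b bF /= bA]|/hasPn/= FA] := boolP (has (fun i => i \in A) F).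
  rewrite (big_fsetD1 b)//= bA big_seq big1 ?addr0// => i.
  rewrite !inE => /andP[ib iF]; case: (boolP (i \in A)) => // iA.
  by rewrite (chain_antichain_meet CF CA iF bF iA bA) eqxx in ib.
by rewrite big_seq big1 ?ler01// => i /FA /negbTE ->.
Qed.

(** [T] reads off coordinates and [S] is the pairing. Both bounds are 1, so the identification is
    even isometric. *)
Lemma Xspace_dual_isomorphic : isomorphic (dual (Xspace R f)) (Yspace R nf).
Proof.
have coordY (phi : dual (Xspace R f)) : (fun i => phi (unit_vec i)) \in Yset nf.
  by apply/asboolP; apply: le_lt_trans (functional_coord phi) (ltry _).
pose T (phi : dual (Xspace R f)) : Yspace R nf := MkY (coordY phi).
pose S (y : Yspace R nf) : dual (Xspace R f) := MkDual (pairing_dual y).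
apply: (@isomorphic_of_bounds _ _ _ T S 1 1).
- by move=> a phi psi; apply: val_inj.
- move=> phi; apply: val_inj; apply/funext => x /=.
  exact/cvg_lim/functional_series.
- move=> y; apply: val_inj; apply/funext => n /=.
  (* The partial sums against the unit vector are constant from rank [n.+1] on, where term [n] has
     entered. *)
  apply/cvg_lim => //; apply: cvg_near_cst; exists n.+1 => // m /= nm.
  rewrite /series/= (bigD1_seq n) ?iota_uniq ?mem_index_iota//= eqxx mul1r.
  by rewrite big1 ?addr0// => i /negbTE ->; rewrite mul0r.
- move=> phi; rewrite mul1r -lee_fin fineK; first exact: functional_coord.
  by rewrite ge0_fin_numE ?chain_norm_ge0//; apply/asboolP; exact: coordY.
- move=> y; rewrite mul1r; apply: dual_norm_le => x x1.
  apply: le_trans (pairing_le (XvalY x) (valP y)) _.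
  by apply: ler_piMl => //; rewrite fine_ge0// chain_norm_ge0.
Qed.

End duality.
End chain_norm_theory.

Theorem corollary5p4 (R : realType) (f : nat -> rat) (hf : bijective f) :
  isomorphic (dual (Xspace R f)) (Yspace R f).
Proof.
apply: isomorphic_trans (Yspace_opp_isomorphic R hf).
exact/Xspace_dual_isomorphic/bij_inj.
Qed.
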